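(* Let $a\in\mathbb{R}$, $n\ge2$, and let $\mathcal{L}=\{(x_1,\dots,x_{n-1},a):(x_1,\dots,x_{n-1})\in\mathbb{R}^{n-1}\}\subset\mathbb{R}^n$. Then $\omega^\times(\mathcal{L})=n\,\sigma(a)$.
   Context: $\Pi_+(\mathbf{q})=\prod_{i=1}^n\max(1,|q_i|)$; $\omega^\times(\mathbf{y})=\sup\{v\mid$ infinitely many $\mathbf{q}\in\mathbb{Z}^n$ with $|\langle\mathbf{q},\mathbf{y}\rangle+p|<\Pi_+(\mathbf{q})^{-v/n}$ for some $p\in\mathbb{Z}\}$; $\omega^\times(\mathcal{L})=\sup\{v\mid\lambda\{\mathbf{y}\in\mathcal{L}:\omega^\times(\mathbf{y})>v\}>0\}$ where $\lambda$ is Lebesgue measure on $\mathcal{L}$. For $a\in\mathbb{R}$, $\sigma(a)=\sup\{v\mid$ there are infinitely many $q\in\mathbb{Z}$ with $|qa+p|<|q|^{-v}$ for some $p\in\mathbb{Z}\}$. *)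

(* Defs.v *)
From HB Require Import structures.
From mathcomp Require Import all_boot all_order all_algebra.
From mathcomp Require Import all_classical all_reals all_analysis.

Set Implicit Arguments.
Unset Strict Implicit.
Unset Printing Implicit Defensive.

Import Order.TTheory GRing.Theory Num.Theory.
Import numFieldNormedType.Exports.

Local Open Scope classical_set_scope.
Local Open Scope ring_scope.

(* The library has no Lebesgue measure on R^m; it is built here on m.-tuple R,
   with the library's product sigma-algebra, by iterating product measures.
   [lebesgue_tuple_box] below gives its value on boxes. *)
Section cons_measure.
Local Open Scope ereal_scope.
Context {R : realType} {m : nat}.
Local Notation RT := (measurableTypeR R).
Variable mu : {sigma_finite_measure set (m.-tuple RT) -> \bar R}.

Definition cons_pair (p : RT * m.-tuple RT) : m.+1.-tuple RT :=
  [tuple of p.1 :: p.2].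

Definition uncons_pair (t : m.+1.-tuple RT) : RT * m.-tuple RT :=
  (thead t, [tuple of behead t]).

Lemma cons_pairK : cancel cons_pair uncons_pair.
Proof.
by move=> [x t]; congr pair; exact: val_inj.
Qed.

Lemma uncons_pairK : cancel uncons_pair cons_pair.
Proof. by move=> t; rewrite [RHS]tuple_eta. Qed.

Lemma measurable_cons_pair : measurable_fun [set: RT * m.-tuple RT] cons_pair.
Proof.
exact: (measurable_cons (f := fst) (g := snd) measurable_fst measurable_snd).
Qed.

Lemma measurable_uncons_pair : measurable_fun [set: m.+1.-tuple RT] uncons_pair.
Proof.
apply/measurable_fun_pairP; split.
- exact: (measurable_tnth ord0).
- exact: measurable_behead.
Qed.

Definition cons_measure : set (m.+1.-tuple RT) -> \bar R :=
  pushforward (lebesgue_measure \x mu) cons_pair.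

Let measurable_preimage A : measurable A -> measurable (cons_pair @^-1` A).
Proof.
by move=> mA; rewrite -[X in measurable X]setTI; exact: measurable_cons_pair.
Qed.

Let cons_measure0 : cons_measure set0 = 0.
Proof. by rewrite /cons_measure /pushforward preimage_set0 measure0. Qed.

Let cons_measure_ge0 A : 0 <= cons_measure A.
Proof. exact: (measure_ge0 (lebesgue_measure \x mu)). Qed.

Let cons_measure_sigma_additive : semi_sigma_additive cons_measure.
Proof.
move=> F mF tF mUF; rewrite /cons_measure /pushforward preimage_bigcup.
apply: measure_semi_sigma_additive.
- by move=> n; exact: measurable_preimage.
- apply/trivIsetP => /= i j _ _ ij; rewrite -preimage_setI.
  by move/trivIsetP : tF => /(_ _ _ _ _ ij) ->//; rewrite preimage_set0.
- by rewrite -preimage_bigcup; exact: measurable_preimage.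
Qed.

HB.instance Definition _ := isMeasure.Build _ _ _
  cons_measure cons_measure0 cons_measure_ge0 cons_measure_sigma_additive.

Let cons_measure_sigma_finite : sigma_finite setT cons_measure.
Proof.
have /sigma_finiteP[F [FT ndF Foo]] := sigma_finiteT (@lebesgue_measure R).
have /sigma_finiteP[G [GT ndG Goo]] := sigma_finiteT mu.
exists (fun k => uncons_pair @^-1` (F k `*` G k)).
  apply/esym; rewrite -subTset => t _.
  have : [set: RT] (uncons_pair t).1 by [].
  have : [set: m.-tuple RT] (uncons_pair t).2 by [].
  rewrite FT GT => -[k _ Gk] [l _ Fl]; exists (maxn k l) => //; split.
  - by move: Fl; exact/subsetPset/ndF/leq_maxr.
  - by move: Gk; exact/subsetPset/ndG/leq_maxl.
move=> k; have [mF Fk] := Foo k; have [mG Gk] := Goo k; split.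
  rewrite -[X in measurable X]setTI; apply: measurable_uncons_pair => //.
  exact: measurableX.
rewrite /cons_measure /pushforward.
rewrite (_ : cons_pair @^-1` _ = F k `*` G k).
  by rewrite product_measure1E// lte_mul_pinfty// ge0_fin_numE.
by apply/funext => p; rewrite [LHS](congr1 (F k `*` G k) (cons_pairK p)).
Qed.

HB.instance Definition _ := Measure_isSigmaFinite.Build _ _ _
  cons_measure cons_measure_sigma_finite.

End cons_measure.

Fixpoint lebesgue_tuple (R : realType) (m : nat) :
    {sigma_finite_measure set (m.-tuple (measurableTypeR R)) -> \bar R} :=
  match m with
  | 0 => \d_([tuple] : 0.-tuple (measurableTypeR R))
  | m'.+1 => cons_measure (lebesgue_tuple R m')
  end.

Lemma lebesgue_tuple_box (R : realType) (m : nat)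
    (A : 'I_m -> set (measurableTypeR R)) : (forall i, measurable (A i)) ->
  lebesgue_tuple R m [set x | forall i, A i (tnth x i)] =
  (\big[*%E/1]_(i < m) lebesgue_measure (A i))%E.
Proof.
elim: m A => [|m IHm] A mA.
  rewrite big_ord0 /= diracE mem_set// => -[] //.
rewrite big_ord_recl /= /cons_measure /pushforward.
set B := [set x : m.-tuple (measurableTypeR R) |
  forall i, A (lift ord0 i) (tnth x i)].
have mB : measurable B.
  rewrite (_ : B = \bigcap_(i in [set: 'I_m])
    ((fun x : m.-tuple (measurableTypeR R) => tnth x i) @^-1` A (lift ord0 i))).
    apply: fin_bigcap_measurable => // i _.
    by rewrite -[X in measurable X]setTI; exact: measurable_tnth.
  by apply/seteqP; split => [x Bx i _|x Bx i]; [exact: Bx|exact: Bx].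
rewrite (_ : _ @^-1` _ = A ord0 `*` B).
  by rewrite product_measure1E//; congr (_ * _)%E; exact: IHm.
apply/seteqP; split => [[x t] /= H|[x t] /= [Ax At] i].
  split; first exact: (H ord0).
  by move=> i; have := H (lift ord0 i); rewrite tnthS.
by have [j ->|->//] := unliftP ord0 i; rewrite tnthS; exact: At.
Qed.

Section exponents.
Context {R : realType}.

Definition Pi_plus (n : nat) (q : n.-tuple int) : R :=
  \prod_(i < n) Num.max 1 `|(tnth q i)%:~R|.

Definition pairing (n : nat) (q : n.-tuple int) (y : n.-tuple R) : R :=
  \sum_(i < n) (tnth q i)%:~R * tnth y i.

Definition omega_times (n : nat) (y : n.-tuple R) : \bar R :=
  ereal_sup [set v%:E | v in [set v : R |
    infinite_set [set q : n.-tuple int | exists p : int,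
      `|pairing q y + p%:~R| < Pi_plus q `^ (- (v / n%:R))]]].

(* At q = 0, where |q|^{-v} is not meaningful, powR returns some real number;
   a single q does not affect whether the set is infinite. *)
Definition sigma (a : R) : \bar R :=
  ereal_sup [set v%:E | v in [set v : R |
    infinite_set [set q : int | exists p : int,
      `|q%:~R * a + p%:~R| < `|q%:~R| `^ (- v)]]].

Definition omega_times_set (n : nat) (lam : set (n.-tuple R) -> \bar R)
    (L : set (n.-tuple R)) : \bar R :=
  ereal_sup [set v%:E | v in [set v : R |
    (0 < lam (L `&` [set y | (v%:E < omega_times y)%E]))%E]].

(* (x_1, ..., x_{n-1}, a): position n.-1 is past the end of x, so [nth] returns
   its default a there. *)
Definition hyperplane_point (n : nat) (a : R) (x : n.-1.-tuple R) : n.-tuple R :=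
  [tuple nth a x i | i < n].

Definition hyperplane (n : nat) (a : R) : set (n.-tuple R) :=
  range (@hyperplane_point n a).

(* Lebesgue measure on the hyperplane, carried over from R^{n-1} by the
   isometry [hyperplane_point].  The outer measure [^*] agrees with
   [lebesgue_tuple] on Borel sets and with its completion on Lebesgue
   measurable sets. *)
Definition hyperplane_measure (n : nat) (a : R) (A : set (n.-tuple R)) : \bar R :=
  ((lebesgue_tuple R n.-1)^*)%mu (@hyperplane_point n a @^-1` A).

End exponents.

Arguments hyperplane_point {R} n a x.
Arguments hyperplane {R} n a _.
Arguments hyperplane_measure {R} n a A.

(* Main.v *)
(** Vectors of the form (0, ..., 0, q) turn approximations of [a] into
multiplicative approximations of every point of the hyperplane, so that
[n * sigma a] is a lower bound.  Conversely let [v > n * sigma a] and put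
[s = v / n]; by Dirichlet's theorem [sigma a >= 1], hence [s > 1].  The
condition on (0, ..., 0, q) has finitely many solutions since [s > sigma a].
For a fixed [q] whose first n - 1 entries do not all vanish, the points [x] of
a cube satisfying the condition form a union of strips of measure
[O(Pi_plus q ^ (- s))].  The sum of these bounds over all [q] is dominated by
the n-th power of the sum of [max (1, |j|) ^ (- s)] over the integers [j], which
is finite, so by the Borel-Cantelli lemma almost no [x] belongs to infinitely
many strips. *)
Require Import Defs.
From mathcomp Require Import all_boot all_order all_algebra.
From mathcomp Require Import all_classical all_reals all_analysis.
From mathcomp Require Import measurable_realfun zify ring lra.
Import Order.TTheory GRing.Theory Num.Theory.
Import numFieldNormedType.Exports.

Local Open Scope classical_set_scope.
Local Open Scope ring_scope.

(** * Convergence of the series of n^(-s) for real s > 1 *)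

(** Discrete counterpart of comparing the series of n^(-t-1) with an integral: summed over [n], the
    right-hand side telescopes. *)
Lemma powR_telescope (R : realType) (t : R) (n : nat) : 0 < t ->
  t * n.+2%:R `^ (- (t + 1)) <= n.+1%:R `^ (- t) - n.+2%:R `^ (- t).
Proof.
move=> t0; set x : R := n.+1%:R; set y : R := n.+2%:R.
have x0 : 0 < x by rewrite ltr0n.
have y0 : 0 < y by rewrite ltr0n.
have yx : y = x + 1 by rewrite /y -addn1 natrD.
have z0 : 0 < x / y by rewrite divr_gt0.
have ey : y * y^-1 = 1 by rewrite mulfV// gt_eqF.
(* Bernoulli's inequality in the form (1 - 1/y)^(-t) >= 1 + t/y. *)
have bern : 1 + t / y <= (x / y) `^ (- t).
  rewrite /powR gt_eqF//; apply: le_trans (expR_ge1Dx _).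
  rewrite lerD2l mulNr -mulrN ler_pM2l// lerNr.
  have -> : x / y = 1 + - y^-1 by rewrite -[x](addrK 1) -yx mulrBl ey mul1r.
  apply: le_ln1Dx; rewrite ltrN2 invf_lt1// yx; lra.
have -> : x = x / y * y by rewrite -mulrA mulVf ?mulr1// gt_eqF.
rewrite powRM ?(ltW z0) ?(ltW y0)// opprD powRD; last first.
  by rewrite (gt_eqF y0) implybT.
rewrite powR_inv1 ?(ltW y0)// [y `^ _ * y^-1]mulrC mulrA.
by rewrite lerBrDl; have := ler_wpM2r (powR_ge0 y (- t)) bern; rewrite mulrDl mul1r.
Qed.

Lemma nneseries_riemannR_lty (R : realType) (s : R) : 1 < s ->
  (\sum_(0 <= n <oo) (n.+1%:R `^ (- s))%:E < +oo :> \bar R)%E.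
Proof.
move=> s1; have t0 : 0 < s - 1 by rewrite subr_gt0.
apply: (@le_lt_trans _ _ (1 + (s - 1)^-1)%:E); last exact: ltry.
apply: lime_le; first by apply: is_cvg_nneseries => *; rewrite lee_fin powR_ge0.
apply: nearW => N; rewrite sumEFin lee_fin.
case: N => [|N]; first by rewrite big_geq// addr_ge0// invr_ge0 (ltW t0).
(* An explicit bound on the partial sums, carried through the induction by [powR_telescope] with t =
   s - 1. *)
suff : \sum_(0 <= n < N.+1) n.+1%:R `^ (- s) <=
    1 + (s - 1)^-1 * (1 - N.+1%:R `^ (- (s - 1))).
  by move=> /le_trans; apply; rewrite lerD2l ler_piMr ?invr_ge0 ?(ltW t0)//.
elim: N => [|N IH]; first by rewrite big_nat1 !powR1 subrr mulr0 addr0.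
rewrite big_nat_recr//=; apply: le_trans (lerD IH (lexx _)) _.
suff : N.+2%:R `^ (- s) <=
    (s - 1)^-1 * (N.+1%:R `^ (- (s - 1)) - N.+2%:R `^ (- (s - 1))).
  by rewrite !mulrBr; lra.
by rewrite ler_pdivlMl// -{2}(subrK 1 s) powR_telescope.
Qed.

(** * Sums over countable index sets and the Borel-Cantelli lemma *)

Lemma esum_cmul_le (R : realType) (T : choiceType) (D : set T) (c : R)
    (f : T -> \bar R) : 0 <= c -> (forall i, (0 <= f i)%E) ->
  (\esum_(i in D) (c%:E * f i) <= c%:E * \esum_(i in D) f i)%E.
Proof.
move=> c0 f0; apply: ge_ereal_sup => _ [X XD <-].
rewrite -ge0_mule_fsumr// lee_wpmul2l ?lee_fin//.
by apply: ereal_sup_ubound; exists X.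
Qed.

(** The sequential Borel-Cantelli lemma transported along [pickle]: [G] lists the sets [F i] by code
    and is empty at numbers that code nothing, which leaves the sum of measures unchanged. *)
Lemma borel_cantelli_countType (d : measure_display) (T : measurableType d)
    (R : realType) (mu : {measure set T -> \bar R}) (I : countType) (F : I -> set T) :
    (forall i, measurable (F i)) -> (\esum_(i in [set: I]) mu (F i) < +oo)%E ->
  mu.-negligible [set x | infinite_set [set i | F i x]].
Proof.
move=> mF sF; pose G k := oapp F set0 (pickle_inv k).
have mG k : measurable (G k) by rewrite /G; case: pickle_inv => /=.
exists (lim_sup_set G); split.
- by apply: bigcapT_measurable => k; exact: bigcup_measurable.
- apply: lim_sup_set_cvg0 => //; rewrite nneseries_esumT//.
  rewrite (_ : (fun i => _) =
      fun k => if k \in range (@pickle I) then mu (G k) else 0%E); last first.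
    apply/funext => k; case: ifPn => // /negP; rewrite inE => kI.
    rewrite /G; case: pickle_inv (@pickle_invK I k) => [i /= ik|_].
      by exfalso; apply: kI; exists i.
    by rewrite /= measure0.
  rewrite -esum_mkcond esum_image; last first.
    by move=> i j _ _; exact: (pcan_inj pickleK_inv).
  by under eq_esum => i _ do rewrite /G pickleK_inv.
(* If [x] lies in no [G j] with j >= k, every [i] with [F i x] has a code below [k]; as [pickle] is
   injective, there are finitely many. *)
- move=> x xF k _; apply: contrapT => kG; apply: xF.
  apply: (@sub_finite_set _ _ (pickle @^-1` [set` iota 0 k])).
    move=> i Fi /=; rewrite mem_iota/= add0n ltnNge; apply/negP => ki.
    by apply: kG; exists (pickle i) => //; rewrite /G pickleK_inv.
  apply: finite_preimage; first by move=> i j _ _; exact: (pcan_inj pickleK_inv).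
  exact: finite_seq.
Qed.

(** The positive and the negative integers each contribute the series of (n + 1)^(-s); the term at 0
    is split off. *)
Lemma esum_int_lty (R : realType) (s : R) : 1 < s ->
  (\esum_(j in [set: int]) ((Num.max 1 `|j%:~R|) `^ (- s))%:E < +oo :> \bar R)%E.
Proof.
move=> s1; pose g (j : int) : \bar R := ((Num.max 1 `|j%:~R|) `^ (- s))%:E.
rewrite -/g.
have g0 j : (0 <= g j)%E by rewrite lee_fin powR_ge0.
have gS n : g (Posz n.+1) = (n.+1%:R `^ (- s))%:E.
  by rewrite /g -pmulrn normr_nat max_r// ler1n.
have gN n : g (Negz n) = (n.+1%:R `^ (- s))%:E.
  by rewrite /g NegzE mulrNz normrN -pmulrn normr_nat max_r// ler1n.
rewrite (esumID (range Negz))// setTI setTI.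
rewrite (_ : ~` range Negz = range Posz); last first.
  apply/seteqP; split => [[n|n]|_ [n _ <-] [m _ //]]; first by exists n.
  by move=> /(_ (ex_intro2 _ _ n I erefl)).
rewrite !esum_image; try by move=> i j _ _ [].
apply: lte_add_pinfty.
  rewrite (eq_esum (b := fun n => (n.+1%:R `^ (- s))%:E)); last first.
    by move=> n _; exact: gN.
  by rewrite -nneseries_esumT ?nneseries_riemannR_lty// => n;
    rewrite lee_fin powR_ge0.
rewrite -nneseries_esumT; last by move=> n; exact: g0.
rewrite nneseries_recl => [||//]; last by move=> n _; exact: g0.
apply: lte_add_pinfty; first exact: ltry.
rewrite -(nneseries_addn 1); last by move=> n; exact: g0.
rewrite (eq_eseriesr (g := fun n => (n.+1%:R `^ (- s))%:E)).
  exact: nneseries_riemannR_lty.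
by move=> n _; rewrite addn1; exact: gS.
Qed.

Lemma Pi_plus_cons (R : realType) (n : nat) (j : int) (q : n.-tuple int) :
  Pi_plus [tuple of j :: q] = Num.max 1 `|j%:~R| * Pi_plus q :> R.
Proof.
rewrite /Pi_plus big_ord_recl; congr (_ * _).
by apply: eq_bigr => i _; rewrite tnthS.
Qed.

Lemma Pi_plus_ge1 (R : realType) (n : nat) (q : n.-tuple int) :
  1 <= Pi_plus q :> R.
Proof.
apply: (big_ind (fun z => 1 <= z)) => // [x y x1 y1|i _].
  by rewrite mulr_ege1.
by rewrite le_max lexx.
Qed.

(** [Pi_plus] is multiplicative in the entries, so the sum over tuples factors into [n] copies of
    the sum over the integers; the induction splits off one entry at a time. *)
Lemma esum_Pi_plus_lty (R : realType) (n : nat) (s : R) : 1 < s ->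
  (\esum_(q in [set: n.-tuple int]) (Pi_plus q `^ (- s))%:E < +oo :> \bar R)%E.
Proof.
move=> s1; elim: n => [|n IH].
  rewrite (_ : [set: _] = [set [tuple]]); last first.
    by apply/seteqP; split => // q _ /=; rewrite [q]tuple0.
  by rewrite esum_set1 ?ltry// lee_fin powR_ge0.
pose e (p : int * n.-tuple int) := [tuple of p.1 :: p.2].
rewrite (reindex_esum [set: int * n.-tuple int] setT e); last first.
  split => //; first by move=> [i q] [j r] _ _ /(congr1 val)/= [-> /val_inj ->].
  by move=> q _; exists (thead q, [tuple of behead q]) => //; rewrite [RHS]tuple_eta.
pose g (j : int) : R := (Num.max 1 `|j%:~R|) `^ (- s).
pose h j (q : n.-tuple int) := ((g j)%:E * (Pi_plus q `^ (- s))%:E)%E.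
rewrite (eq_esum (b := fun p => h p.1 p.2)); last first.
  move=> [j q] _; rewrite /h /g /e /= Pi_plus_cons powRM ?EFinM//.
  by apply: le_trans (Pi_plus_ge1 _ _ _).
rewrite (_ : setT = setT `*`` (fun=> setT)); last by apply/seteqP.
set S := (\esum_(q in _) _)%E in IH.
have S0 : (0 <= S)%E by apply: esum_ge0 => q _; rewrite lee_fin powR_ge0.
rewrite -(esum_esum (a := h)); last first.
  by move=> *; rewrite /h -EFinM lee_fin mulr_ge0 ?powR_ge0.
(* The sum over tails is finite by induction, so it can be pulled out as the real constant
   [fine S]. *)
apply: (@le_lt_trans _ _ (\esum_(j in [set: int]) ((fine S)%:E * (g j)%:E))%E).
  apply: le_esum => j _; rewrite muleC fineK.
    by apply: esum_cmul_le; [exact: powR_ge0 | move=> q; rewrite lee_fin powR_ge0].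
  by rewrite ge0_fin_numE// S0.
apply: (le_lt_trans (esum_cmul_le _ _ _ _ _ _ _)).
- exact: fine_ge0.
- by move=> j; rewrite lee_fin powR_ge0.
- by rewrite lte_mul_pinfty ?lee_fin ?fine_ge0 ?esum_int_lty.
Qed.

(** * Measure of strips in a cube *)

(** The distance from [z] to the nearest integer is less than [d]. *)
Definition near_int {R : realType} (d : R) : set R :=
  [set z | exists p : int, `|z + p%:~R| < d].

Lemma measurable_near_int (R : realType) (d : R) :
  measurable (near_int d : set (measurableTypeR R)).
Proof.
have -> : near_int d = \bigcup_(p : int) ball (- p%:~R : R) d.
  apply/seteqP; split => z [p].
    by move=> zp; exists p; rewrite // /ball/= -opprD normrN addrC.
  by move=> _; rewrite /ball/= -opprD normrN addrC; exists p.
by apply: open_measurable; apply: bigcup_open => p _; exact: ball_open.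
Qed.

Lemma measurable_near_int_affine (R : realType) (K : nat) (j : int) (c d : R) :
  measurable [set x : measurableTypeR R |
    `|x| <= K%:R /\ near_int d (j%:~R * x + c)].
Proof.
rewrite (_ : [set x | _] =
    `[- K%:R, K%:R] `&` ((fun x => j%:~R * x + c) @^-1` near_int d)).
  apply: measurableI => //; rewrite -[X in measurable X]setTI.
  apply: (_ : measurable_fun setT _) => //; last exact: measurable_near_int.
  by apply: measurable_funD => //; apply: measurable_funM.
apply/seteqP; split => x /=; rewrite in_itv/= -ler_norml => -[]; by split.
Qed.

(* [j x + c + p] is within [d <= 1] of 0 for at most 2 (K |j| + 2) + 1 integers
   [p], and each of them contributes an interval of length [2 d / |j|]. *)
Lemma near_int_affine_le (R : realType) (K : nat) (j : int) (c d : R) :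
    j != 0 -> 0 <= d <= 1 ->
  (lebesgue_measure [set x : measurableTypeR R |
     (`|x| <= K%:R)%R /\ near_int d (j%:~R * x + c)%R]
   <= ((4 * K%:R + 10) * d)%:E)%E.
Proof.
move=> j0 /andP[d0 d1]; set A := [set x | _].
have j0' : 0 < `|j%:~R : R| by rewrite normr_gt0 intr_eq0.
have mA : measurable A by exact: measurable_near_int_affine.
(* The integers [p] are recentred at the floor of -c, so that their number does not depend on [c];
   the index [i] stands for the offset i - M. *)
pose M := (K * `|j| + 2)%N.
pose F i : set (measurableTypeR R) :=
  ball (- (c + (Num.floor (- c) + (i%:Z - M%:Z))%:~R) / j%:~R : R) (d / `|j%:~R|).
have AF : A `<=` \big[setU/set0]_(i < 2 * M + 1) F i.
  rewrite -bigcup_mkord => x [xK [p xp]].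
  set r : int := p - Num.floor (- c).
  have rM : `|r%:~R| <= M%:R :> R.
    have -> : r%:~R = (j%:~R * x + c + p%:~R) - j%:~R * x
        - (c + (Num.floor (- c))%:~R) :> R by rewrite /r rmorphB/=; ring.
    apply: (le_trans (ler_normB _ _)).
    have fc : `|c + (Num.floor (- c))%:~R| <= 1.
      have /andP[f1 f2] := floor_itv (- c).
      rewrite ler_norml; move: f1 f2; rewrite rmorphD/=; lra.
    have jx : `|j%:~R * x| <= `|j%:~R| * K%:R by rewrite normrM ler_wpM2l.
    have := ler_normB (j%:~R * x + c + p%:~R) (j%:~R * x).
    rewrite natrD natrM natr_absz intr_norm.
    move: xp fc jx; lra.
  have rM' : `|r| <= M%:Z by rewrite -(ler_int R) intr_norm.
  exists (absz (r + M%:Z)); first by rewrite /=; lia.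
  rewrite /F /ball/=.
  have -> : Num.floor (- c) + ((absz (r + M%:Z))%:Z - M%:Z) = p by rewrite /r; lia.
  rewrite ltr_pdivlMr// -normrM.
  rewrite (_ : (_ - _) * _ = - (j%:~R * x + c + p%:~R)) ?normrN//.
  by rewrite mulrBl mulrVK ?unitfE ?intr_eq0//; ring.
apply: (le_trans (content_subadditive _ _ _ AF)) => //.
  by move=> i _; exact: measurable_ball.
rewrite (eq_bigr (fun=> (d / `|j%:~R| *+ 2)%:E)); last first.
  by move=> i _; apply: lebesgue_measure_ball; rewrite divr_ge0.
rewrite sumEFin lee_fin sumr_const card_ord.
rewrite -[_ *+ (_ + _)]mulr_natr -[_ *+ 2]mulr_natr.
rewrite [leRHS]mulrC -!mulrA ler_wpM2l//.
(* The total length (4 K |j| + 10) d / |j| is at most (4 K + 10) d because |j| >= 1, a bound uniform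
   in [j]. *)
have j1 : 1 <= `|j%:~R : R|.
  by rewrite -intr_norm (ler_int _ 1); lia.
rewrite ler_pdivrMl// /M natrD natrM natrD natrM natr_absz intr_norm mulrDr.
lra.
Qed.

Lemma measurable_pairing (R : realType) (m : nat) (q : m.-tuple int) :
  measurable_fun setT (fun x : m.-tuple (measurableTypeR R) => pairing q x).
Proof.
rewrite /pairing; apply: measurable_sum => i.
by apply: measurable_funM => //; exact: measurable_tnth.
Qed.

(** For nonzero [q], parallel slabs orthogonal to [q], cut down to a cube to have finite measure;
    [c] will be the contribution of the fixed last coordinate. *)
Definition cube_strip {R : realType} {m : nat} (K : nat)
    (q : m.-tuple int) (c d : R) : set (m.-tuple (measurableTypeR R)) :=
  [set x | (forall i, `|tnth x i| <= K%:R) /\ near_int d (pairing q x + c)].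

Lemma cubeE (R : realType) (m K : nat) :
  [set x : m.-tuple (measurableTypeR R) | forall i, `|tnth x i| <= K%:R] =
  [set x | forall i, `[- K%:R, K%:R]%classic (tnth x i)].
Proof.
by apply/seteqP; split => x xK i; have := xK i; rewrite /= in_itv/= -ler_norml.
Qed.

Lemma measurable_cube (R : realType) (m K : nat) :
  measurable [set x : m.-tuple (measurableTypeR R) |
    forall i, `|tnth x i| <= K%:R].
Proof.
rewrite cubeE (_ : [set x | _] = \bigcap_(i in [set: 'I_m])
    ((fun x : m.-tuple (measurableTypeR R) => tnth x i) @^-1` `[- K%:R, K%:R])).
  apply: fin_bigcap_measurable => // i _.
  by rewrite -[X in measurable X]setTI; exact: measurable_tnth.
by apply/seteqP; split => [x xK i _|x xK i]; exact: xK.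
Qed.

Lemma measurable_cube_strip (R : realType) (m K : nat) (q : m.-tuple int)
  (c d : R) : measurable (cube_strip K q c d).
Proof.
apply: measurableI; first exact: measurable_cube.
rewrite -[X in measurable X]setTI.
apply: (_ : measurable_fun setT (fun x => pairing q x + c)) => //.
  by apply: measurable_funD => //; exact: measurable_pairing.
exact: measurable_near_int.
Qed.

Lemma lebesgue_itv_sym (R : realType) (K : nat) :
  lebesgue_measure (`[- K%:R, K%:R]%classic : set (measurableTypeR R)) =
  (2 * K%:R)%:E.
Proof.
rewrite lebesgue_measure_itv/= lte_fin; case: ltP => [_|KK].
  by rewrite -EFinD; congr EFin; ring.
have K0 : (0 : R) <= K%:R by [].
by congr EFin; lra.
Qed.

Lemma lebesgue_cube (R : realType) (m K : nat) :
  lebesgue_tuple R m [set x | forall i, `|tnth x i| <= K%:R] =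
  ((2 * K%:R) ^+ m)%:E.
Proof.
rewrite cubeE (@lebesgue_tuple_box R m (fun=> `[- K%:R, K%:R]%classic))//.
rewrite (eq_bigr (fun=> (2 * K%:R)%:E)) => [|i _]; last exact: lebesgue_itv_sym.
by rewrite prodEFin prodr_const card_ord.
Qed.

(** Induction on the dimension by Fubini. That [C] does not depend on [q] and [c] is what allows
    summation over all [q]. *)
Lemma lebesgue_cube_strip_le (R : realType) (m K : nat) :
  exists C : R, 0 <= C /\ forall (q : m.-tuple int) (c d : R),
    (exists i, tnth q i != 0) -> 0 <= d <= 1 ->
    (lebesgue_tuple R m (cube_strip K q c d) <= (C * d)%:E)%E.
Proof.
elim: m => [|m [C [C0 IH]]].
  by exists 0; split => // q c d [[]].
(* One summand for each case below: nonzero tail of [q], zero tail of [q]. *)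
exists (C * (2 * K%:R) + (4 * K%:R + 10) * (2 * K%:R) ^+ m); split.
  by rewrite addr_ge0 ?mulr_ge0 ?exprn_ge0 ?addr_ge0 ?mulr_ge0.
move=> q c d q0 d01; have /andP[d0 d1] := d01.
pose r := [tuple of behead q].
have pcons x t : pairing q (cons_pair (x, t)) =
    (tnth q ord0)%:~R * x + pairing r t :> R.
  rewrite /pairing big_ord_recl; congr (_ + _).
  apply: eq_bigr => i _; rewrite tnthS tnth_behead.
  congr ((tnth q _)%:~R * _).
  by apply: val_inj; rewrite /= inordK ?ltnS// /bump leq0n.
have cubecons x t : (forall i, `|tnth (cons_pair (x, t)) i| <= K%:R) <->
    `|x| <= K%:R /\ forall i, `|tnth t i| <= K%:R :> R.
  split => [H|[Hx Ht] i].
    by split => [|i]; [exact: (H ord0)|have := H (lift ord0 i); rewrite tnthS].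
  by have [k ->|->//] := unliftP ord0 i; rewrite tnthS; exact: Ht.
have mpre : measurable (cons_pair @^-1` cube_strip K q c d).
  rewrite -[X in measurable X]setTI; apply: measurable_cons_pair => //.
  exact: measurable_cube_strip.
have K0 : (0 : R) <= K%:R by [].
have : 0 <= (4 * K%:R + 10) * (2 * K%:R) ^+ m * d :> R.
  by rewrite !mulr_ge0 ?exprn_ge0 ?mulr_ge0//; lra.
have : 0 <= C * (2 * K%:R) * d by rewrite !mulr_ge0.
have : 0 <= (2 * K%:R) ^+ m :> R by rewrite exprn_ge0 ?mulr_ge0.
set X := (2 * K%:R) ^+ m; move=> X0 CKd KXd.
rewrite /= /cons_measure /pushforward.
(* Nonzero tail: the slice at a fixed first coordinate [x] is a strip for the tail with shift q_0 x
   + c, and it is empty unless |x| <= K. *)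
have [r0|r0] := pselect (exists i, tnth r i != 0).
  apply: (@le_trans _ _ (C * d * (2 * K%:R))%:E); last first.
    by rewrite lee_fin; lra.
  have mI : measurable (`[- K%:R, K%:R]%classic : set (measurableTypeR R)) by [].
  rewrite /product_measure1.
  apply: (@le_trans _ _
      (\int[lebesgue_measure]_(x in `[(- K%:R)%R, K%:R%R]) cst (C * d)%:E x)%E).
    rewrite [leRHS]integral_mkcond; apply: ge0_le_integral => //.
    - exact: measurable_fun_xsection.
    - by apply/(measurable_restrictT _ mI).
    move=> x _ /=; rewrite patchE; case: ifPn => [xK|xK].
      apply: le_trans (IH r ((tnth q ord0)%:~R * x + c) d r0 d01).
      rewrite le_measure ?inE//.
      + exact: measurable_xsection.
      + exact: measurable_cube_strip.
      move=> t /xsectionP[/cubecons[_ tK]]; rewrite pcons => H.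
      by split => //; rewrite addrA [pairing r t + _]addrC.
    rewrite (_ : xsection _ _ = set0) ?measure0//.
    rewrite -subset0 => t /xsectionP[/cubecons[xK' _] _].
    by move: xK; rewrite notin_setE; apply; rewrite /= in_itv/= -ler_norml.
  rewrite integral_cst// [X in (_ * X)%E](lebesgue_itv_sym R K) -EFinM.
  exact: lexx.
have r0' i : tnth r i = 0 by apply/eqP/negP => H; apply: r0; exists i; exact/negP.
have q00 : tnth q ord0 != 0.
  case: q0 => i; have [k ->|->//] := unliftP ord0 i.
  move=> /eqP[]; rewrite -[RHS](r0' k) tnth_behead; congr (tnth q _).
  by apply: val_inj; rewrite /= inordK ?ltnS// /bump leq0n.
(* Zero tail: the pairing depends on the first coordinate alone, so the set is a one-dimensional
   strip times a cube. *)
rewrite (_ : cons_pair @^-1` _ = [set x | `|x| <= K%:R /\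
    near_int d ((tnth q ord0)%:~R * x + c)] `*`
    [set t : m.-tuple (measurableTypeR R) | forall i, `|tnth t i| <= K%:R]).
  rewrite product_measure1E//; last 2 first.
    exact: measurable_near_int_affine.
    exact: measurable_cube.
  apply: (@le_trans _ _ (((4 * K%:R + 10) * d)%:E * X%:E)%E).
    rewrite lebesgue_cube lee_wpmul2r ?lee_fin//.
    exact: near_int_affine_le.
  by rewrite -EFinM lee_fin; lra.
have pr0 t : pairing r t = 0 :> R.
  by rewrite /pairing big1// => i _; rewrite r0' mul0r.
apply/seteqP; split => [[x t] [/cubecons[xK tK]]|[x t] [/= [xK H] tK]].
  by rewrite pcons pr0 addr0.
by split; [apply/cubecons | rewrite pcons pr0 addr0].
Qed.

(** * Dirichlet's theorem and the lower bound for [sigma] *)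

(** Pigeonhole: among the N + 2 multiples 0, a, ..., (N + 1) a, two have fractional parts in the
    same of N + 1 boxes of width 1 / (N + 1); [q] is the difference of their indices. *)
Lemma dirichlet_approximation (R : realType) (a : R) (N : nat) :
  exists q : nat, (0 < q <= N.+1)%N /\
    exists p : int, `|q%:R * a + p%:~R| < N.+1%:R^-1.
Proof.
have N0 : (0 : R) < N.+1%:R by [].
pose fr (k : nat) : R := k%:R * a - (Num.floor (k%:R * a))%:~R.
have fr01 k : 0 <= fr k < 1.
  have /andP[f1 f2] := floor_itv (k%:R * a).
  by move: f1 f2; rewrite /fr rmorphD/=; lra.
pose box (k : nat) : int := Num.floor (N.+1%:R * fr k).
have boxP k : (box k)%:~R <= N.+1%:R * fr k < (box k)%:~R + 1.
  by have := floor_itv (N.+1%:R * fr k); rewrite [(_ + 1)%:~R]rmorphD.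
have box_lt k : 0 <= box k < N.+1%:Z.
  have /andP[f0 f1] := fr01 k; rewrite /box floor_ge0 mulr_ge0//=.
  rewrite -(ltr_int R); apply: (le_lt_trans (floor_le _)).
  by rewrite -[ltRHS]mulr1 ltr_pM2l.
(* By [box_lt] neither [absz] nor [inord] identifies distinct boxes. *)
pose f (k : 'I_N.+2) : 'I_N.+1 := inord (absz (box k)).
have : ~~ injectiveb f.
  by apply/negP => /injectiveP /leq_card; rewrite !card_ord ltnn.
move=> /injectivePn[k [l kl]] /(congr1 val); rewrite /f /=.
have /andP[k0 k1] := box_lt k; have /andP[l0 l1] := box_lt l.
rewrite !inordK; [|lia|lia] => bkl.
have {}bkl : box k = box l by lia.
wlog {kl} kl : k l bkl k0 k1 l0 l1 / (k < l)%N.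
  move=> H; case: (ltngtP k l) => [lt|lt|/val_inj/eqP]; [| |by rewrite (negPf kl)].
    exact: H lt.
  exact: H lt.
exists (l - k)%N; split; first by have := ltn_ord l; lia.
exists (Num.floor (k%:R * a) - Num.floor (l%:R * a)).
rewrite (_ : _ + _ = fr l - fr k); last first.
  by rewrite natrB 1?ltnW// rmorphB/= /fr; ring.
rewrite -[ltRHS]mulr1 ltr_pdivlMl// -[X in X * _]ger0_norm// -normrM.
have /andP[bk1 bk2] := boxP k; have /andP[bl1 bl2] := boxP l.
rewrite bkl in bk1 bk2; rewrite mulrBr.
move: (_ * fr k) (_ * fr l) (box l)%:~R bk1 bk2 bl1 bl2 => u v w *.
by rewrite ltr_norml; apply/andP; split; lra.
Qed.

(** The exponent 1 itself has infinitely many solutions, by Dirichlet's theorem with growing [N]. *)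
Lemma sigma_ge1 (R : realType) (a : R) : (1 <= sigma a)%E.
Proof.
apply: ereal_sup_ubound; exists 1 => //= finS.
have approx N : exists q : nat, (0 < q)%N /\
    exists p : int, `|q%:R * a + p%:~R| < N.+1%:R^-1 /\
    [set q : int | exists p : int, `|q%:~R * a + p%:~R| < `|q%:~R| `^ (- 1)] q.
  have [q [/andP[q0 qN] [p qp]]] := dirichlet_approximation _ a N.
  exists q; split => //; exists p; split => //; exists p.
  rewrite powR_inv1// normr_nat; apply: (lt_le_trans qp).
  by rewrite lef_pV2 ?posrE ?ltr0n// ler_nat.
(* Rational [a]: every positive multiple of the denominator [q] is a solution with error 0. *)
have [[q [p [q0 qp]]]|irr] :=
    pselect (exists q : nat, exists p : int, (0 < q)%N /\ q%:R * a + p%:~R = 0).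
  apply: infinite_nat.
  apply: (@sub_finite_set _ _ ((fun k : nat => (k.+1 * q)%N%:Z) @^-1`
      [set q : int | exists p : int, `|q%:~R * a + p%:~R| < `|q%:~R| `^ (- 1)])).
    move=> k _ /=; exists (k.+1%:Z * p).
    rewrite -pmulrn natrM rmorphM/= -mulrA -mulrDr qp mulr0 normr0 powR_gt0//.
    by rewrite normr_gt0 mulf_neq0// pnatr_eq0 -lt0n.
  apply: finite_preimage finS => k l _ _ [] /eqP.
  by rewrite eqn_pmul2r// => /eqP[].
(* Irrational [a]: for each q > 0, the number q a keeps a positive distance [e] from the
   integers. *)
have sep (q : int) : exists N : nat, (0 < q) -> forall p : int,
    N.+1%:R^-1 <= `|q%:~R * a + p%:~R|.
  case: q => [q|q]; last by exists 0%N.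
  pose x := q%:R * a; have /andP[f1 f2] := floor_itv x.
  pose e := Num.min (x - (Num.floor x)%:~R) ((Num.floor x + 1)%:~R - x).
  have [q0|q0] := posnP q; first by exists 0%N; rewrite q0.
  have e0 : 0 < e.
    rewrite lt_min !subr_gt0 f2 andbT lt_neqAle f1 andbT.
    apply/eqP => fx; apply: irr; exists q, (- Num.floor x); split => //.
    by rewrite rmorphN/= fx subrr.
  exists (Num.bound e^-1) => _ p.
  have Ne : (Num.bound e^-1).+1%:R^-1 <= e.
    rewrite invf_ple ?posrE//; apply: ltW; apply: (lt_le_trans (archi_boundP _)).
      by rewrite invr_ge0 ltW.
    by rewrite ler_nat.
  apply: (le_trans Ne); rewrite -pmulrn -/x ge_min.
  have [pf|pf] := leP (- Num.floor x) p.
    have : (- Num.floor x)%:~R <= p%:~R :> R by rewrite ler_int.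
    rewrite rmorphN/= => H; apply/orP; left; rewrite ger0_norm; lra.
  have : (p + 1)%:~R <= (- Num.floor x)%:~R :> R by rewrite ler_int; lia.
  rewrite rmorphN !rmorphD/=; move: f2; rewrite rmorphD/= => f2 H.
  apply/orP; right; rewrite ler0_norm; lra.
have [g gP] := choice sep.
have /finite_seqP[X SX] := finS.
(* For this [N], Dirichlet's theorem yields a member of the finite solution set closer to an integer
   than [g] permits. *)
have [q [q0 [p [qp Sq]]]] := approx (\max_(j <- X) g j).
have := gP q q0 p; rewrite leNgt => /negP; apply.
apply: (lt_le_trans qp); rewrite lef_pV2 ?posrE// ler_nat ltnS.
by apply: leq_bigmax_seq => //; rewrite SX in Sq.
Qed.

(** * Integer vectors paired with points of the hyperplane *)

Definition tuple_init {T : Type} {m : nat} (q : m.+1.-tuple T) : m.-tuple T :=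
  [tuple tnth q (widen_ord (leqnSn m) i) | i < m].

Lemma pairing_hyperplane (R : realType) (a : R) (m : nat)
    (q : m.+1.-tuple int) (x : m.-tuple R) :
  pairing q (hyperplane_point m.+1 a x) =
  pairing (tuple_init q) x + (tnth q ord_max)%:~R * a.
Proof.
rewrite /pairing big_ord_recr /= tnth_mktuple nth_default ?size_tuple//.
congr (_ + _); apply: eq_bigr => i _; rewrite !tnth_mktuple.
by rewrite [tnth x i](tnth_nth a).
Qed.

Definition last_axis (m : nat) (j : int) : m.+1.-tuple int :=
  [tuple if i == ord_max then j else 0 | i < m.+1].

Lemma last_axis_inj (m : nat) : injective (last_axis m).
Proof.
by move=> i j /(congr1 (fun q => tnth q ord_max)); rewrite !tnth_mktuple eqxx.
Qed.

Lemma last_axis_tnth (m : nat) (q : m.+1.-tuple int) :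
  ~ (exists i, tnth (tuple_init q) i != 0) -> last_axis m (tnth q ord_max) = q.
Proof.
move=> q0; apply: eq_from_tnth => i; rewrite tnth_mktuple.
case: eqP => [->//|/eqP im]; apply/esym/eqP/negP => /negP qi.
have im' : (i < m)%N.
  by have := ltn_ord i; move: im; rewrite -val_eqE /=; lia.
apply: q0; exists (Ordinal im'); rewrite tnth_mktuple.
by rewrite (_ : widen_ord _ _ = i)//; exact: val_inj.
Qed.

Lemma pairing_last_axis (R : realType) (a : R) (m : nat) (j : int)
    (x : m.-tuple R) :
  pairing (last_axis m j) (hyperplane_point m.+1 a x) = j%:~R * a.
Proof.
rewrite pairing_hyperplane tnth_mktuple eqxx /pairing big1 ?add0r// => i _.
rewrite !tnth_mktuple ifF ?mul0r//.
by apply/negbTE; rewrite -val_eqE /= neq_ltn ltn_ord.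
Qed.

Lemma Pi_plus_last_axis (R : realType) (m : nat) (j : int) :
  Pi_plus (last_axis m j) = Num.max 1 `|j%:~R| :> R.
Proof.
rewrite /Pi_plus big_ord_recr /= tnth_mktuple eqxx big1 ?mul1r// => i _.
rewrite tnth_mktuple ifF ?normr0; first by rewrite max_l.
by apply/negbTE; rewrite -val_eqE /= neq_ltn ltn_ord.
Qed.

(** Away from 0 the weights in [omega_times] and [sigma] agree on the last axis; at 0 [Pi_plus] is
    1, not |0|. *)
Lemma Pi_plus_last_axis_neq0 (R : realType) (m : nat) (j : int) :
  j != 0 -> Pi_plus (last_axis m j) = `|j%:~R| :> R.
Proof.
move=> j0; rewrite Pi_plus_last_axis max_r// -intr_norm (ler_int _ 1).
by lia.
Qed.

(** * Almost every point, and the two inequalities *)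

(** Borel-Cantelli on each cube, then a countable union over [K]. Vectors on the last axis are left
    out because their condition does not involve [x]. *)
Lemma negligible_infinitely_near_int (R : realType) (a s : R) (m : nat) :
    1 < s ->
  (lebesgue_tuple R m).-negligible [set x | infinite_set
    [set q : m.+1.-tuple int | (exists i, tnth (tuple_init q) i != 0) /\
      near_int (Pi_plus q `^ (- s))
        (pairing (tuple_init q) x + (tnth q ord_max)%:~R * a)]].
Proof.
move=> s1; pose F K (q : m.+1.-tuple int) :=
  if `[< exists i, tnth (tuple_init q) i != 0 >]
  then cube_strip K (tuple_init q) ((tnth q ord_max)%:~R * a) (Pi_plus q `^ (- s))
  else set0.
apply: (@negligibleS _ _ _ _
    (\bigcup_K [set x | infinite_set [set q | F K q x]])); last first.
  apply: negligible_bigcup => K; apply: borel_cantelli_countType => [q|].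
    by rewrite /F; case: ifP => // _; exact: measurable_cube_strip.
  have [C [C0 HC]] := lebesgue_cube_strip_le R m K.
  apply: (@le_lt_trans _ _ (C%:E *
      \esum_(q in [set: m.+1.-tuple int]) (Pi_plus q `^ (- s))%:E)%E).
    apply: le_trans (esum_cmul_le _ _ _ _ _ _ _) => //; last first.
      by move=> q; rewrite lee_fin powR_ge0.
    apply: le_esum => q _; rewrite /F; case: asboolP => [q0|_]; last first.
      by rewrite measure0 -EFinM lee_fin mulr_ge0 ?powR_ge0.
    rewrite -EFinM; apply: HC => //; rewrite powR_ge0/=.
    by rewrite -[leRHS](powRr0 (Pi_plus q)) ler_powR ?Pi_plus_ge1//; lra.
  by rewrite lte_mul_pinfty ?lee_fin ?esum_Pi_plus_lty.
(* This [K] bounds every coordinate of [x], so [x] lies in the cube. *)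
move=> x xinf; exists (\sum_(i < m) Num.bound `|tnth x i|%R)%N => // finF.
apply: xinf; apply: sub_finite_set finF => q [q0 qx] /=.
rewrite /F ifT; last exact/asboolP.
split => // i; apply: ltW; apply: (lt_le_trans (archi_boundP _)) => //.
by rewrite ler_nat (bigD1 i)//= leq_addr.
Qed.

Theorem theorem5p1 (R : realType) (a : R) (n : nat) (hn : (2 <= n)%N) :
  omega_times_set (hyperplane_measure n a) (hyperplane n a)
  = (n%:R%:E * sigma a)%E.
Proof.
case: n hn => // m _.
have n0 : (0 : R) < m.+1%:R by rewrite ltr0n.
have sigma1 := sigma_ge1 _ a.
pose A (u : R) := [set q : int | exists p : int,
  `|q%:~R * a + p%:~R| < `|q%:~R| `^ (- u)].
apply/eqP; rewrite eq_le; apply/andP; split.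
  (* Upper bound, by contraposition: if v > n sigma(a), the points with exponent above [v] have
     outer measure zero. *)
  apply: ge_ereal_sup => _ [v /= + <-].
  apply: contraPT; rewrite -ltNge => vsigma.
  pose s := v / m.+1%:R.
  have sigma_s : (sigma a < s%:E)%E.
    by rewrite -lte_pdivlMl// in vsigma; rewrite /s mulrC EFinM.
  have s1 : 1 < s by rewrite -lte_fin (le_lt_trans sigma1).
  have finA : finite_set (A s).
    apply: contrapT => infA; move: sigma_s; rewrite ltNge => /negP; apply.
    by apply: ereal_sup_ubound; exists s.
  have [N [mN N0 subN]] := negligible_infinitely_near_int _ a _ m s1.
  apply/negP; rewrite -leNgt -N0 -(measurable_mu_extE _ mN).
  apply: le_mu_ext => x [_ /= vx]; apply: subN => /= fin.
  have [_ [w winf <-]] := ereal_sup_gt vx; rewrite lte_fin => vw.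
  (* Solutions for w > v are solutions for [s]; they lie off the last axis, or on it with last entry
     in [A s] or equal to 0, where [A s] says nothing about [Pi_plus]. *)
  apply: winf; apply: (@sub_finite_set _ _
    ([set q : m.+1.-tuple int | (exists i, tnth (tuple_init q) i != 0) /\
      near_int (Pi_plus q `^ (- s))
        (pairing (tuple_init q) x + (tnth q ord_max)%:~R * a)] `|`
     (last_axis m @` (A s `|` [set 0])))); last first.
    rewrite finite_setU; split => //; apply: finite_image.
    by rewrite finite_setU.
  move=> q [p qp].
  have {}qp : `|pairing q (hyperplane_point m.+1 a x) + p%:~R| <
      Pi_plus q `^ (- s).
    apply: (lt_le_trans qp); rewrite ler_powR ?Pi_plus_ge1//.
    by rewrite lerN2 ler_pM2r ?invr_gt0// ltW.
  have [q0|q0] := pselect (exists i, tnth (tuple_init q) i != 0).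
    by left; split => //; exists p; rewrite -pairing_hyperplane.
  right; exists (tnth q ord_max); last exact: last_axis_tnth.
  have [->|j0] := eqVneq (tnth q ord_max) 0; first by right.
  have qE := last_axis_tnth _ _ q0.
  set j := tnth q ord_max in qE j0 *; left; exists p; move: qp.
  by rewrite -qE pairing_last_axis Pi_plus_last_axis_neq0.
rewrite -lee_pdivlMl//; apply: ge_ereal_sup => _ [u /= infA <-].
(* Lower bound: [omega_times_set] asks for exponents strictly above [v], hence the loss of an
   arbitrary e > 0. *)
rewrite lee_pdivlMl// -EFinM; apply/lee_addgt0Pr => e e0.
rewrite -leeBlDr// -EFinB; apply: ereal_sup_ubound.
exists (m.+1%:R * u - e) => //=.
have omega_gt x : ((m.+1%:R * u - e)%:E <
    omega_times (hyperplane_point m.+1 a x))%E.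
  apply: (@lt_le_trans _ _ (m.+1%:R * u)%:E); first by rewrite lte_fin; lra.
  apply: ereal_sup_ubound; exists (m.+1%:R * u) => //= fin.
  apply: (infinite_setD infA (finite_set1 0)).
  apply: (@sub_finite_set _ _ (last_axis m @^-1` _) _ (finite_preimage _ fin)).
    move=> j [[p jp] /eqP j0]; exists p.
    by rewrite pairing_last_axis Pi_plus_last_axis_neq0// mulrAC mulfV
      ?mul1r ?gt_eqF.
  by move=> i j _ _; exact: last_axis_inj.
(* Every point of the hyperplane qualifies, so the cube [-1, 1]^m, of measure 2^m, already gives
   positive measure. *)
apply: (@lt_le_trans _ _ (lebesgue_tuple R m
    [set x | forall i, `|tnth x i| <= 1%N%:R])).
  by rewrite lebesgue_cube lte_fin exprn_gt0.
rewrite -measurable_mu_extE; last exact: measurable_cube.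
by apply: le_mu_ext => x _; split; [exists x | exact: omega_gt].
Qed.
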